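(* Let $\mathcal{F}$ be the set of finite subsets of $\mathbb{Q}_{>0}$, and let $\rho:\mathbb{Q}_{<0}\to\mathcal{F}$ be a map such that for every $F\in\mathcal{F}$ the fiber $\rho^{-1}(F)$ is dense and codense in $\mathbb{Q}_{<0}$. Let $A\subseteq\mathbb{Q}^2$ be the binary relation defined by $A(x,y)\iff x<0<y$ and $y\in\rho(x)$. Let $\mathcal{R}\succcurlyeq(\mathbb{Q},<,0,A)$ be an $\aleph_1$-saturated elementary extension with infinite elements (relative to the elements of $\mathbb{Q}$). Then the open core of $\mathcal{R}$ is not o-minimal.
   Context: ''Definable'' always means definable with parameters. For a structure $\mathcal{R}=(R,<,\ldots)$ expanding a dense linear order without endpoints, give $R$ the order topology and $R^n$ the product topology. The open core $\mathcal{R}^{\circ}$ of $\mathcal{R}$ is the structure with universe $R$ whose language consists of a relation symbol for each open set $U\subseteq R^n$, for every $n$, that is definable (with parameters) in $\mathcal{R}$. A structure is o-minimal if every subset of its universe definable with parameters is a finite union of points and intervals (with endpoints in the universe or $\pm\infty$). An element of $\mathcal{R}$ is infinite relative to $\mathbb{Q}$ if it is greater than every element of $\mathbb{Q}$. A set $D\subseteq\mathbb{Q}_{<0}$ is codense in $\mathbb{Q}_{<0}$ if $\mathbb{Q}_{<0}\setminus D$ is dense in $\mathbb{Q}_{<0}$. *)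

(* Defs.v *)
From HB Require Import structures.
From mathcomp Require Import all_boot all_order all_algebra finmap.
From mathcomp Require Import all_classical topology.

Set Implicit Arguments.
Unset Strict Implicit.
Unset Printing Implicit Defensive.

Import Order.TTheory GRing.Theory Num.Theory.

Local Open Scope classical_set_scope.

Record language : Type := Language {
  fun_sym : nat -> Type;
  rel_sym : nat -> Type
}.

Inductive term (L : language) (n : nat) : Type :=
| Var of 'I_n
| App m of fun_sym L m & ('I_m -> term L n).

(* Well-scoped first-order formulas: the free variables of a [formula L n] are
   among the [n] variables in 'I_n. A quantifier binds variable 0 of its body,
   whose variable [lift ord0 i] is the variable [i] outside the quantifier. *)
Inductive formula (L : language) : nat -> Type :=
| Bot n : formula L n
| Eq n of term L n & term L n : formula L n
| Rel n m of rel_sym L m & ('I_m -> term L n) : formula L n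
| Imp n of formula L n & formula L n : formula L n
| And n of formula L n & formula L n : formula L n
| Or n of formula L n & formula L n : formula L n
| All n of formula L n.+1 : formula L n
| Ex n of formula L n.+1 : formula L n.

Record structure (L : language) (T : Type) : Type := Structure {
  fun_interp : forall n, fun_sym L n -> ('I_n -> T) -> T;
  rel_interp : forall n, rel_sym L n -> set ('I_n -> T)
}.

Definition vcons (T : Type) (n : nat) (a : T) (v : 'I_n -> T) : 'I_n.+1 -> T :=
  fun k => if unlift ord0 k is Some j then v j else a.

Definition vcat (T : Type) (n m : nat) (v : 'I_n -> T) (p : 'I_m -> T) :
    'I_(n + m) -> T :=
  fun k => match fintype.split k with inl i => v i | inr j => p j end.

Fixpoint eval (L : language) (T : Type) (M : structure L T) (n : nat)
    (v : 'I_n -> T) (t : term L n) : T :=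
  match t with
  | Var i => v i
  | App _ f ts => fun_interp M f (fun j => eval M v (ts j))
  end.

Fixpoint sat (L : language) (T : Type) (M : structure L T) (n : nat)
    (phi : formula L n) : ('I_n -> T) -> Prop :=
  match phi in formula _ n return ('I_n -> T) -> Prop with
  | Bot _ => fun _ => False
  | Eq _ t u => fun v => eval M v t = eval M v u
  | Rel _ _ r ts => fun v => rel_interp M r (fun j => eval M v (ts j))
  | Imp _ f g => fun v => sat M f v -> sat M g v
  | And _ f g => fun v => sat M f v /\ sat M g v
  | Or _ f g => fun v => sat M f v \/ sat M g v
  | All _ f => fun v => forall a, sat M f (vcons a v)
  | Ex _ f => fun v => exists a, sat M f (vcons a v)
  end.

(* A formula in [n] free variables with finitely many parameters from [T]. *)
Record pformula (L : language) (T : Type) (n : nat) : Type := PFormula {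
  pf_size : nat;
  pf_formula : formula L (n + pf_size);
  pf_param : 'I_pf_size -> T
}.

Definition psat (L : language) (T : Type) (M : structure L T) (n : nat)
    (g : pformula L T n) (v : 'I_n -> T) : Prop :=
  sat M (pf_formula g) (vcat v (@pf_param L T n g)).

Definition definable (L : language) (T : Type) (M : structure L T) (n : nat)
    (S : set ('I_n -> T)) : Prop :=
  exists g : pformula L T n, S = [set v | psat M g v].

Definition elementary_embedding (L : language) (T U : Type)
    (M : structure L T) (N : structure L U) (i : T -> U) : Prop :=
  forall n (phi : formula L n) (v : 'I_n -> T), sat M phi v <-> sat N phi (i \o v).

(* Every 1-type over a set [C] of fewer than aleph_1 parameters is realized. *)
Definition aleph1_saturated (L : language) (T : Type) (M : structure L T) :
    Prop :=
  forall C : set T, countable C ->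
  forall G : set (pformula L T 1),
    (forall g, G g -> forall j, C (@pf_param L T 1 g j)) ->
    (forall F : set (pformula L T 1), finite_set F -> F `<=` G ->
      exists x : T, forall g, F g -> psat M g (fun=> x)) ->
    exists x : T, forall g, G g -> psat M g (fun=> x).

(* [open] refers to the product topology of the order topologies. *)
Definition open_core_language d (T : orderType d) (L : language)
    (M : structure L T) : language :=
  {| fun_sym := fun=> void;
     rel_sym := fun n => {U : set ('I_n -> T) |
       open (U : set (prod_topology (fun _ : 'I_n => order_topology T)))
       /\ definable M U} |}.

Definition open_core d (T : orderType d) (L : language) (M : structure L T) :
    structure (open_core_language M) T :=
  {| fun_interp := fun n (f : fun_sym (open_core_language M) n) _ =>
       match f with end;
     rel_interp := fun n (U : rel_sym (open_core_language M) n) => sval U |}.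

(* [interval T] contains intervals of all kinds (open or closed ends, possibly
   infinite); those with a closed end are an open interval plus points. *)
Definition o_minimal d (T : orderType d) (L : language) (M : structure L T) :
    Prop :=
  forall S : set T, definable M [set v : 'I_1 -> T | S (v ord0)] ->
  exists (P : seq T) (I : seq (interval T)),
    S = [set` P] `|` \bigcup_(J in [set` I]) [set` J].

Inductive ordA_fun : nat -> Type := ZeroSym : ordA_fun 0.
Inductive ordA_rel : nat -> Type := LtSym : ordA_rel 2 | ASym : ordA_rel 2.
Definition ordA_language : language := Language ordA_fun ordA_rel.

Definition ordA_structure d (T : orderType d) (z : T) (A : T -> T -> Prop) :
    structure ordA_language T :=
  @Structure ordA_language T
    (fun n f => match f in ordA_fun n return ('I_n -> T) -> T with
                | ZeroSym => fun=> z
                end)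
    (fun n r => match r in ordA_rel n return set ('I_n -> T) with
                | LtSym => [set v | (v ord0 < v ord_max)%O]
                | ASym => [set v | A (v ord0) (v ord_max)]
                end).

Definition Qneg : Type := {x : rat | (x < 0)%R}.
Definition Qpos : choiceType := {x : rat | (0 < x)%R}.

Definition Qneg_topology : topologicalType :=
  initial_topology (sval : Qneg -> order_topology rat).

Definition dense_Qneg (D : set Qneg) : Prop := dense (D : set Qneg_topology).

Definition codense_Qneg (D : set Qneg) : Prop := dense_Qneg (~` D).

Definition A_of (rho : Qneg -> {fset Qpos}) (x y : rat) : Prop :=
  exists (hx : (x < 0)%R) (hy : (0 < y)%R),
    (exist _ y hy : Qpos) \in rho (exist _ x hx).

(* Main.v *)
Require Import Defs.
From HB Require Import structures.
From mathcomp Require Import all_boot all_order all_algebra finmap.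
From mathcomp Require Import all_classical topology.

Local Open Scope classical_set_scope.

(** By saturation some [x] in [R] satisfies [A(x, q)] for all positive rationals [q] at once, since
    every finite set of positive rationals is a value of [rho]. The fibers of [A] are finite in [Q],
    and two first-order consequences of this transfer to [R]: each fiber is closed, and it contains
    no nondegenerate segment. The complement of the fiber of [x] is therefore a symbol of the open
    core, where an o-minimal structure would force the fiber to be finite. *)

Set Implicit Arguments.
Unset Strict Implicit.
Unset Printing Implicit Defensive.

Import Order.TTheory GRing.Theory Num.Theory.

Section FirstOrder.
Context {L : language} {T : Type}.

Lemma vcons0 n (a : T) (v : 'I_n -> T) : vcons a v ord0 = a.
Proof. by rewrite /vcons unlift_none. Qed.

Lemma vconsS n (a : T) (v : 'I_n -> T) j : vcons a v (lift ord0 j) = v j.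
Proof. by rewrite /vcons liftK. Qed.

Lemma vcatl n m (v : 'I_n -> T) (p : 'I_m -> T) i : vcat v p (lshift m i) = v i.
Proof. by rewrite /vcat (unsplitK (inl i)). Qed.

Lemma vcatr n m (v : 'I_n -> T) (p : 'I_m -> T) j : vcat v p (rshift n j) = p j.
Proof. by rewrite /vcat (unsplitK (inr j)). Qed.

Definition Rel2 n (r : rel_sym L 2) (a b : 'I_n) : formula L n :=
  Rel r (fun j => Var L (if j == ord0 then a else b)).

Definition Not n (phi : formula L n) : formula L n := Imp phi (Bot L n).

End FirstOrder.
Arguments Rel2 {L n} r a b.
Arguments Not {L n} phi.

Section OpenCore.
Context {d : Order.disp_t} {R : orderType d} {L : language} (M : structure L R).

(** The language of the open core names open sets only, so [S] is reached by negating the symbol of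
    its complement. *)
Lemma open_core_definable_closed (S : set R) :
  open (~` S : set (order_topology R)) -> definable M [set v : 'I_1 -> R | S (v ord0)] ->
  definable (open_core M) [set v : 'I_1 -> R | S (v ord0)].
Proof.
move=> oS [g gS].
pose U : set ('I_1 -> R) := [set v | ~ S (v ord0)].
have oU : open (U : set (prod_topology (fun _ : 'I_1 => order_topology R))).
  apply: (@open_comp (prod_topology (fun=> order_topology R)) _ (proj ord0)) oS => v _.
  exact: proj_continuous.
have dU : definable M U.
  exists (PFormula (Not (pf_formula g)) (@pf_param _ _ _ g)).
  apply/seteqP; split=> v /=; rewrite /psat /= => nS Sv; apply: nS.
    by have : [set v | psat M g v] v by []; rewrite -gS.
  by have : [set v : 'I_1 -> R | S (v ord0)] v by []; rewrite gS.
pose r : rel_sym (open_core_language M) 1 := exist _ U (conj oU dU).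
pose phi : formula (open_core_language M) (1 + 0) := Not (Rel r (fun=> Var _ (lshift 0 ord0))).
(* The parameters of [g] are absorbed into the symbol [r], so the new formula has none. *)
exists (PFormula phi (fun k : 'I_0 => False_rect R (notF (ltn_ord k)))).
by apply/seteqP; split=> v /=; rewrite /psat /= /U /= vcatl; [move=> Sv; apply|move=> /contrapT].
Qed.

(** Each interval in the decomposition of [S] is convex, so two distinct points of it would give a
    whole segment inside [S]; hence it has at most one point. *)
Lemma o_minimal_finite_closed (S : set R) : o_minimal (open_core M) ->
  open (~` S : set (order_topology R)) -> definable M [set v : 'I_1 -> R | S (v ord0)] ->
  (forall y v, (y < v)%O -> exists w, (y < w < v)%O /\ ~ S w) -> finite_set S.
Proof.
move=> omin oS dS thinS.
have [P [I SE]] := omin S (open_core_definable_closed oS dS).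
rewrite SE finite_setU; split; first exact: finite_seq.
apply: bigcup_finite => [|J IJ]; first exact: finite_seq.
have JS : [set` J] `<=` S by rewrite SE => y Jy; right; exists J.
have Jle y v : [set` J] y -> [set` J] v -> ~ (y < v)%O.
  move=> Jy Jv /thinS [w [/andP[yw wv]]]; apply; apply: JS.
  move: Jy Jv; case: (J) => l u /=; rewrite !itv_boundlr.
  move=> /andP[ly _] /andP[_ vu]; apply/andP; split.
    by apply: (le_trans ly); rewrite bnd_simp ltW.
  by apply: le_trans vu; rewrite bnd_simp ltW.
have [->|/set0P[y Jy]] := eqVneq [set` J] set0; first exact: finite_set0.
apply: (@sub_finite_set _ _ [set y]); last exact: finite_set1.
move=> v Jv; case: (ltgtP v y) => // h; by [case: (Jle v y)|case: (Jle y v)].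
Qed.

End OpenCore.

Local Notation shift := (lift ord0).
Local Notation LtF := (@Rel2 ordA_language _ LtSym).
Local Notation AF := (@Rel2 ordA_language _ ASym).

(** Finiteness of the fibers is not a first-order property; this consequence of it is. From the
    outside in, the bound variables are [x], [y], [b], [w]. *)
Definition thin_fibers : formula ordA_language 0 :=
  All (All (All (Imp (LtF (shift ord0) ord0)
    (Ex (And (And (LtF (shift (shift ord0)) ord0) (LtF ord0 (shift ord0)))
      (Not (AF (shift (shift (shift ord0))) ord0))))))).

(** Openness of the complement becomes first-order by quantifying over the endpoints of basic
    intervals. From the outside in, the bound variables are [x], [y], [a], [b], [w]. *)
Definition closed_fibers : formula ordA_language 0 :=
  All (All (Imp (Not (AF (shift ord0) ord0))
    (Ex (Ex (And
      (And (LtF (shift ord0) (shift (shift ord0))) (LtF (shift (shift ord0)) ord0))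
      (All (Imp (LtF (shift (shift ord0)) ord0) (Imp (LtF ord0 (shift ord0))
        (Not (AF (shift (shift (shift (shift ord0)))) ord0)))))))))).

Section Fibers.
Context {d : Order.disp_t} {T : orderType d} (z : T) (A : T -> T -> Prop).

Lemma sat_thin_fibers v : sat (ordA_structure z A) thin_fibers v <->
  forall x y b, (y < b)%O -> exists w, (y < w < b)%O /\ ~ A x w.
Proof.
rewrite /thin_fibers /=; split => H x y b; move: (H x y b); rewrite !(vcons0, vconsS) => {}H yb.
  have [w] := H yb; rewrite !(vcons0, vconsS) => -[[yw wb] Aw].
  by exists w; rewrite yw wb.
by have [w [/andP[yw wb] Aw]] := H yb; exists w; rewrite !(vcons0, vconsS).
Qed.

Lemma sat_closed_fibers v : sat (ordA_structure z A) closed_fibers v <->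
  forall x y, ~ A x y ->
    exists a b, (a < y < b)%O /\ forall w, (a < w < b)%O -> ~ A x w.
Proof.
rewrite /closed_fibers /=; split => H x y; move: (H x y); rewrite !(vcons0, vconsS) => {}H Axy.
  have [a [b]] := H Axy; rewrite !(vcons0, vconsS) => -[[ay yb] Aw].
  exists a, b; split; first by rewrite ay.
  by move=> w /andP[aw wb]; move: (Aw w); rewrite !(vcons0, vconsS); apply.
have [a [b [/andP[ay yb] Aw]]] := H Axy; exists a, b; rewrite !(vcons0, vconsS).
split=> // w; rewrite !(vcons0, vconsS) => aw wb.
by apply: Aw; rewrite aw.
Qed.

Lemma definable_fiber x : definable (ordA_structure z A) [set v : 'I_1 -> T | A x (v ord0)].
Proof.
exists (@PFormula ordA_language T 1 1 (AF (rshift 1 ord0) (lshift 1 ord0)) (fun=> x)).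
by apply/seteqP; split=> v; rewrite /psat /= vcatl vcatr.
Qed.

End Fibers.

Section Rational.
Local Open Scope ring_scope.

(** Induction on [s]: a new point other than [y] replaces the endpoint on its side if it is closer
    to [y]. The point [y] may itself lie in [s]. *)
Lemma rat_isolated (s : seq rat) (y : rat) :
  exists a b, a < y < b /\ forall w, a < w < b -> w \in s -> w = y.
Proof.
elim: s => [|u s [a [b [/andP[ay yb] H]]]].
  by exists (y - 1), (y + 1); rewrite gtrDl ltrDl ltrN10 ltr01.
have [uy|uy|->] := ltgtP u y.
- exists (Num.max a u), b; rewrite gt_max ay uy yb; split=> // w /andP[].
  rewrite gt_max => /andP[aw uw] wb; rewrite in_cons => /orP[/eqP wu|].
    by rewrite wu ltxx in uw.
  by apply: H; rewrite aw.
- exists a, (Num.min b u); rewrite lt_min ay uy yb; split=> // w /andP[aw].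
  rewrite lt_min => /andP[wb wu]; rewrite in_cons => /orP[/eqP wu'|].
    by rewrite wu' ltxx in wu.
  by apply: H; rewrite aw.
- exists a, b; rewrite ay yb; split=> // w wab; rewrite in_cons => /orP[/eqP//|].
  exact: H.
Qed.

Variable rho : Qneg -> {fset Qpos}.

Lemma A_of_finite x : exists s : seq rat, forall y, A_of rho x y -> y \in s.
Proof.
have [hx|hx] := boolP (x < 0); last by exists [::] => y [hx']; rewrite hx' in hx.
exists [seq sval y | y <- rho (exist _ x hx)] => y [hx' [hy]].
rewrite (bool_irrelevance hx' hx) => /(map_f sval); exact.
Qed.

Lemma A_of_thin x y b : y < b -> exists w, y < w < b /\ ~ A_of rho x w.
Proof.
move=> yb; have [s sP] := A_of_finite x.
have [a [c [/andP[ay yc] H]]] := rat_isolated s y.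
(* The midpoint of [y] and [Num.min b c] lies in the isolating interval and differs from [y], so it
   avoids the fiber. *)
have ym : y < Num.min b c by rewrite lt_min yb.
have [yw] := midf_lt ym; rewrite lt_min => /andP[wb wc].
exists ((y + Num.min b c) / 2); rewrite yw wb; split=> // /sP /H.
by rewrite wc (lt_trans ay yw) => /(_ isT) wy; rewrite wy ltxx in yw.
Qed.

Lemma A_of_closed x y : ~ A_of rho x y ->
  exists a b, a < y < b /\ forall w, a < w < b -> ~ A_of rho x w.
Proof.
move=> nA; have [s sP] := A_of_finite x.
have [a [b [ayb H]]] := rat_isolated s y.
by exists a, b; split=> // w /H wy Aw; apply: nA; rewrite -(wy (sP _ Aw)).
Qed.

End Rational.

Lemma dense_Qneg_neq0 (D : set Qneg) : dense_Qneg D -> D !=set0.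
Proof.
(* Density is applied to the whole space, which must first be shown nonempty. *)
pose m : Qneg := exist _ (-1)%R (ltrN10 rat).
by move=> /(_ setT (ex_intro _ m I) openT)[x [_ Dx]]; exists x.
Qed.

Section ElementaryExtension.
Context (rho : Qneg -> {fset Qpos}) (d : Order.disp_t) (R : orderType d) (z : R).
Context (AR : R -> R -> Prop) (i : rat -> R).
Hypothesis hext : elementary_embedding
  (ordA_structure (0%R : rat) (A_of rho)) (ordA_structure z AR) i.

Lemma elementary_inj : injective i.
Proof.
move=> p q ipq.
have /= [_] := hext (Eq (Var ordA_language ord0) (Var _ ord_max)) (fun j : 'I_2 => if j == ord0 then p else q).
exact.
Qed.

Lemma elementary_A p q : A_of rho p q -> AR (i p) (i q).
Proof. by have /= [] := hext (AF ord0 ord_max) (fun j : 'I_2 => if j == ord0 then p else q). Qed.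

Lemma saturated_fiber :
    (forall F : {fset Qpos}, exists x, rho x = F) -> aleph1_saturated (ordA_structure z AR) ->
  exists x, forall q : Qpos, AR x (i (sval q)).
Proof.
move=> rho_surj hsat.
(* The free variable stands in the first place of [A] and the parameter in the second; all
   parameters lie in the countable range of [i]. *)
pose fib (q : Qpos) : pformula ordA_language R 1 :=
  @PFormula ordA_language R 1 1 (AF (lshift 1 ord0) (rshift 1 ord0)) (fun=> i (sval q)).
have fibE q x : psat (ordA_structure z AR) (fib q) (fun=> x) = AR x (i (sval q)).
  by rewrite /psat /= vcatl vcatr.
have [|g [q _ <-] j|F finF FG|x xP] := hsat (range i) _ (range fib).
- exact/(card_le_trans (card_image_le _ _))/countableP.
- by exists (sval q).
(* Choose a rational for each formula in [F]; the value 1 outside [F] is a mere default. *)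
- have [e eP] : {e : pformula ordA_language R 1 -> Qpos & forall g, F g -> fib (e g) = g}.
    apply: (@choice _ _ (fun g q => F g -> fib q = g)) => g.
    have [/FG [q _ <-]|nFg] := pselect (F g); first by exists q.
    by exists (exist _ 1%R ltr01).
  have finE : finite_set (e @` F) by exact: finite_image.
  have [p pE] := rho_surj (fset_set (e @` F)).
  (* The finite set of chosen rationals is the value of [rho] at [p], so [i p] realizes [F]. *)
  case: p pE => p hp pE; exists (i p) => g Fg; rewrite -(eP g Fg) fibE; apply: elementary_A.
  have : e g \in rho (exist _ p hp) by rewrite pE in_fset_set// inE; exists g.
  by case: (e g) => q hq; exists hp, hq.
- by exists x => q; rewrite -fibE; apply: xP; exists q.
Qed.

End ElementaryExtension.

Theorem corollary4p8 (rho : Qneg -> {fset Qpos})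
    (hrho : forall F : {fset Qpos},
      dense_Qneg (rho @^-1` [set F]) /\ codense_Qneg (rho @^-1` [set F]))
    (d : Order.disp_t) (R : orderType d) (z : R) (AR : R -> R -> Prop)
    (i : rat -> R)
    (hext : elementary_embedding
      (ordA_structure (0%R : rat) (A_of rho)) (ordA_structure z AR) i)
    (hsat : aleph1_saturated (ordA_structure z AR))
    (hinf : exists x : R, forall q : rat, (i q < x)%O) :
  ~ o_minimal (open_core (ordA_structure z AR)).
Proof.
move=> omin.
have [|x xP] := saturated_fiber hext _ hsat.
  by move=> F; have [/dense_Qneg_neq0 [p pF] _] := hrho F; exists p.
pose v0 (k : 'I_0) : rat := 0%R.
have thinR : forall x y b, (y < b)%O -> exists w, (y < w < b)%O /\ ~ AR x w.
  apply/(sat_thin_fibers z AR (i \o v0))/hext/sat_thin_fibers; exact: A_of_thin.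
have closedR : forall x y, ~ AR x y ->
    exists a b, (a < y < b)%O /\ forall w, (a < w < b)%O -> ~ AR x w.
  apply/(sat_closed_fibers z AR (i \o v0))/hext/sat_closed_fibers; exact: A_of_closed.
have finA : finite_set (AR x).
  apply: (o_minimal_finite_closed omin _ (definable_fiber z AR x) (thinR x)).
  rewrite openE => y /closedR [a [b [ayb H]]].
  rewrite /interior /= (@itv_nbhsE _ (order_topology R)).
  exists `]a, b[%O; first by [split].
  by move=> w /H.
(* The successor keeps the rationals positive, so every [f n] lies in the fiber of [x]. As [i] is
   injective, a finite fiber would make [nat] finite. *)
pose f (n : nat) := i (n.+1%:R)%R.
apply: infinite_nat; apply: (@sub_finite_set _ _ (f @^-1` AR x)).
  by move=> n _; apply: (xP (exist _ (n.+1%:R)%R (ltr0Sn rat n))).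
apply: finite_preimage finA => m n _ _ /(elementary_inj hext) /eqP.
by rewrite eqr_nat eqSS => /eqP.
Qed.
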